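(* Let $G$ be a profinite-$C$ group. Then the following are equivalent: (i) $G$ is a $C$-group; (ii) $G$ is a torsion group and $|G:Z(G)\overline{G'}|<\infty$, where $\overline{G'}$ is the topological closure of the derived subgroup of $G$. In particular, an abelian profinite-$C$ group is a $C$-group if and only if it is torsion.
   Context: A permutable complement of a subgroup $H$ of a group $G$ is a subgroup $K$ with $G=HK$ and $H\cap K=1$. A group is a $C$-group if every subgroup has a permutable complement. A profinite group $G$ is a profinite-$C$ group if every closed subgroup of $G$ has a closed permutable complement in $G$. $Z(G)$ denotes the center of $G$. *)

(* Defs.v *)
From HB Require Import structures.
From mathcomp Require Import all_boot all_order all_algebra.
From mathcomp Require Import all_classical all_reals all_analysis.

Set Implicit Arguments.
Unset Strict Implicit.
Unset Printing Implicit Defensive.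

Local Open Scope classical_set_scope.

Record topGroup (T : topologicalType) := TopGroup {
  gmul : T -> T -> T;
  ginv : T -> T;
  gone : T;
  gmulA : forall x y z, gmul x (gmul y z) = gmul (gmul x y) z;
  gmul1 : forall x, gmul gone x = x;
  gmulV : forall x, gmul (ginv x) x = gone;
  gmul_cont : continuous (fun p : T * T => gmul p.1 p.2);
  ginv_cont : continuous ginv
}.

Section TopGroupDefs.
Context {T : topologicalType} (G : topGroup T).

Local Notation "x * y" := (gmul G x y).
Local Notation "x ^-1" := (ginv G x).
Local Notation "1" := (gone G).

Definition tg_profinite : Prop :=
  compact [set: T] /\ hausdorff_space T /\ totally_disconnected [set: T].

Definition tg_subgroup (H : set T) : Prop :=
  H 1 /\ (forall x y, H x -> H y -> H (x * y)) /\ (forall x, H x -> H (x^-1)).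

Definition tg_setmul (H K : set T) : set T :=
  [set g | exists h k, H h /\ K k /\ g = h * k].

Definition perm_complement (H K : set T) : Prop :=
  tg_subgroup K /\ tg_setmul H K = [set: T] /\ H `&` K = [set 1].

Definition C_group : Prop :=
  forall H, tg_subgroup H -> exists K, perm_complement H K.

Definition profinite_C_group : Prop :=
  tg_profinite /\
  forall H, tg_subgroup H -> closed H ->
    exists K, closed K /\ perm_complement H K.

Fixpoint gexp (x : T) (n : nat) : T :=
  match n with 0 => 1 | n'.+1 => x * gexp x n' end.

Definition tg_torsion : Prop :=
  forall x : T, exists n : nat, (0 < n)%N /\ gexp x n = 1.

Definition tg_center : set T := [set z | forall x, z * x = x * z].

Definition tg_commutator (x y : T) : T := x^-1 * y^-1 * x * y.

Definition tg_generated (A : set T) : set T :=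
  [set g | forall H, tg_subgroup H -> A `<=` H -> H g].

Definition tg_derived : set T :=
  tg_generated [set c | exists x y, c = tg_commutator x y].

Definition tg_lcosets (H : set T) : set (set T) :=
  [set [set g * h | h in H] | g in [set: T]].

Definition tg_finite_index (H : set T) : Prop := finite_set (tg_lcosets H).

Definition tg_abelian : Prop := forall x y : T, x * y = y * x.

End TopGroupDefs.

(* Main.v *)
Require Import Defs.
From HB Require Import structures.
From mathcomp Require Import all_boot all_order all_algebra all_fingroup all_solvable.

(** Write A for the closure of G'.  A finite group all of whose subgroups are
    complemented is soluble (its elements of least prime order p have complements
    of index p, which are normal) and has trivial second derived subgroup (every
    subgroup of prime index of a soluble group contains it, and the complements of
    elements of prime order meet trivially).  Passing to the finite quotients, A is
    abelian in a profinite-C group G; it has a closed complement B, which is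
    abelian because G' <= A, so that the centraliser of A is contained in Z(G)A.

    An abelian normal subgroup all of whose subgroups are complemented is generated
    by elements x such that <x> is simple and normal; conversely, in an abelian
    group generated by such elements every subgroup has a normal complement.  If G
    is torsion and Z(G)A has finite index, the elements of A have finite conjugacy
    classes, which generate finite (hence closed) normal subgroups; thus A and B
    are generated by elements as above, and a complement of H <= G is the product
    of complements of H & A in A and of AH & B in B.  If G is a C-group, it is
    torsion, hence the generators of A, and therefore all elements of A, have
    finite conjugacy classes; a Baire-type argument in the compact group A then
    shows that the centraliser of A is open. *)

Set Implicit Arguments.
Unset Strict Implicit.
Unset Printing Implicit Defensive.

(** * Finite groups with complemented subgroups *)

Section FiniteComplemented.
Import GroupScope.
Variable gT : finGroupType.
Implicit Types G H K P : {group gT}.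

(* For g in G, the index of K :&: K^g in K divides #|G|; if it is not 1, it is at
   least #|G : K|, and then K K^g = G, which forces g \in K. *)
Lemma normal_index_pdiv G K :
  K \subset G -> #|G : K| = pdiv #|G| -> prime #|G : K| -> K <| G.
Proof.
move=> sKG iGK pr_i; rewrite /normal sKG /=; apply/subsetP => g Gg.
have sKgG : K :^ g \subset G by rewrite -(conjGid Gg) conjSg.
have [g1|g1] := leqP #|K : K :^ g| 1.
  have sKKg : K \subset K :^ g by rewrite -indexg_eq1 eqn_leq g1 indexg_gt0.
  have /eqP EK : (K : {set gT}) == K :^ g by rewrite eqEcard sKKg cardJg leqnn.
  by rewrite inE -EK.
have dvdi : #|K : K :^ g| %| #|G|.
  by apply: dvdn_trans (cardSg sKG); rewrite -indexgI dvdn_indexg.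
have le_p : #|G : K| <= #|K : K :^ g|.
  by rewrite iGK; apply: pdiv_min_dvd.
have cGKK : #|G| <= #|K * (K :^ g)|.
  have := mul_cardG K (K :^ g)%G; rewrite /= cardJg.
  rewrite -{1}(LagrangeI K (K :^ g)%G) /= -mulnA mulnC => /eqP.
  rewrite eqn_pmul2r ?cardG_gt0 // => /eqP <-.
  by rewrite -(Lagrange sKG) mulnC leq_mul2r le_p orbT.
have eGKK : K * (K :^ g) = G.
  by apply/eqP; rewrite eqEcard cGKK mul_subG.
have /mulsgP[k _ Kk /imsetP[k' Kk' ->] Eg] : g \in K * K :^ g by rewrite eGKK.
(* From g = k g^-1 k' g one cancels g to get 1 = k g^-1 k', that is, g = k' k. *)
suff -> : g = k' * k by rewrite (subsetP (normG K)) ?groupM.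
apply: (mulgI g^-1); rewrite mulVg.
move/(congr1 (fun x => x * g^-1)): Eg.
rewrite mulgV /conjg !mulgA mulgK => /(congr1 (fun x => x ^ k)).
by rewrite conj1g /conjg !mulgA mulVg mul1g.
Qed.

(* Let P be the last derived subgroup not contained in K.  Modulo I = P :&: K, it is
   cyclic of prime order, so G' lies in its centraliser P * 'C_K(P), whose derived
   subgroup lies in K. *)
Lemma solvable_prime_index_der2 G K :
  solvable G -> K \subset G -> prime #|G : K| -> G^`(2) \subset K.
Proof.
move=> /derivedP[n Gn1] sKG prGK.
have exi : exists i, G^`(i) \subset K by exists n; rewrite Gn1 sub1G.
have [[|i] sDK mini] := ex_minnP exi.
  exact: subset_trans (der_sub _ _) sDK.
have nsDK : ~~ (G^`(i) \subset K).
  by apply/negP => /mini; rewrite ltnn.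
pose P := G^`(i)%G.
have nPG : P <| G by exact: der_normal.
have sP'K : P^`(1) \subset K by [].
have {}nsDK : ~~ (P \subset K) by [].
move: P => P in nPG sP'K nsDK *.
have sPG : P \subset G by case/andP: nPG.
have nPK : K \subset 'N(P) by apply: subset_trans (normal_norm nPG).
have sPKG : P <*> K \subset G by rewrite join_subG sPG.
(* The index of PK divides the prime |G : K|; if it equalled |G : K|, then P would lie in [K]. *)
have PKG : P * K = G.
  rewrite -(norm_joinEr nPK); apply/eqP; rewrite eqEsubset sPKG /=.
  rewrite -indexg_eq1.
  have E := Lagrange_index sPKG (joing_subr P K).
  have : #|G : (P <*> K)%G| %| #|G : K| by rewrite -E dvdn_mulr.
  have [_ pr] := primeP prGK; move=> /pr /orP[//|/eqP Ei].
  move: E; rewrite /= in Ei; rewrite Ei -[RHS]muln1 => /eqP.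
  rewrite eqn_pmul2l ?prime_gt0 // indexg_eq1 join_subG => /andP[sPK _].
  by rewrite sPK in nsDK.
pose I := (P :&: K)%G.
have sP'I : P^`(1) \subset I.
  by rewrite subsetI der_sub.
have nIG : I <| G.
  rewrite /normal subIset ?sPG //= -PKG mul_subG //=.
    by apply: (sub_der1_norm (H := I)); rewrite ?subsetIl.
  by rewrite normsI // normG.
have sIK : I \subset K by exact: subsetIr.
have [_ nI] := andP nIG.
have nIP : P \subset 'N(I) by apply: subset_trans nI.
have nIK : K \subset 'N(I) by apply: subset_trans nI.
have abP : abelian (P / I) by rewrite sub_der1_abelian.
have cycP : cyclic (P / I).
  apply: prime_cyclic; rewrite card_quotient // /= indexgI.
  by rewrite -indexMg (normC nPK) PKG.
(* Conjugation maps [G / I] into the automorphism group of a cyclic group, which is abelian, so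
   commutators act trivially on [P / I]. *)
have cG'P : (G / I)^`(1) \subset 'C(P / I).
  have nPGq : G / I \subset 'N(P / I) by apply: quotient_norms; case/andP: nPG.
  have abA : abelian (conj_aut (P / I)%G @* (G / I)).
    by apply: abelianS (Aut_conj_aut _ _) (Aut_cyclic_abelian cycP).
  rewrite -ker_conj_aut ker_trivg_morphim morphim_der // (derG1P abA) subxx andbT.
  exact: subset_trans (der_sub _ _) nPGq.
have PKq : (P / I) * (K / I) = G / I by rewrite -quotientMl // PKG.
rewrite -(quotientSGK _ sIK); last by apply: subset_trans (der_sub _ _) _.
rewrite quotient_der //.
(* By the modular law the centraliser is the central product of the abelian group [P / I] and [Kb],
   so its derived subgroup is that of [Kb]. *)
pose Kb := (K / I :&: 'C(P / I))%G.
have cPq : (P / I) * Kb = 'C_(G / I)(P / I).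
  by rewrite -PKq group_modl // abP.
have defC : (P / I) \* Kb = 'C_(G / I)(P / I).
  by rewrite cprodE // subsetIr.
have := der_cprod 1 defC.
rewrite (derG1P abP) cprod1g => E.
apply: subset_trans (subset_trans (der_sub 1 Kb) (subsetIl _ _)).
by rewrite E; apply: (@dergS _ 1 ((G / I)^`(1))%G); rewrite subsetI der_sub.
Qed.

Definition complemented_group (G : {set gT}) :=
  forall H, H \subset G -> [splits G, over H].

(** By the modular law, a complement of [H] in [G] meets [K] in a complement of [H] in [K]. *)
Lemma complemented_group_sub G K :
  K \subset G -> complemented_group G -> complemented_group K.
Proof.
move=> sKG cG H sHK; have /splitsP[L /complP[tiL defG]] := cG H (subset_trans sHK sKG).
apply/splitsP; exists (L :&: K)%G; apply/complP; split.
  by rewrite setIA tiL; apply/setIidPl/sub1G.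
by rewrite group_modl // defG; apply/setIidPr.
Qed.

Lemma complemented_cycle G x :
  complemented_group G -> x \in G ->
  exists2 K : {group gT}, K \subset G & #|G : K| = #[x] /\ <[x]> :&: K = 1.
Proof.
move=> cG Gx; have /splitsP[K /complP[tiK defG]] : [splits G, over <[x]>].
  by apply: cG; rewrite cycle_subG.
exists K; first by rewrite -defG mulG_subr.
by split=> //; rewrite -divgS -defG ?mulG_subr // TI_cardMg // mulnK // cardG_gt0.
Qed.

(** Induction on the order: a complement of an element of least prime order is normal, and its
    quotient has prime order. *)
Lemma complemented_solvable G : complemented_group G -> solvable G.
Proof.
move: {2}#|G| (leqnn #|G|) => n; elim: n G => [|n IHn] G leGn cG.
  by have := leq_trans (cardG_gt0 G) leGn.
have [G1|G1] := eqVneq (G : {set gT}) 1; first by rewrite G1 solvable1.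
have pr_p : prime (pdiv #|G|) by rewrite pdiv_prime // cardG_gt1.
have [x Gx ox] := Cauchy pr_p (pdiv_dvd _).
have [K sKG [iK _]] := complemented_cycle cG Gx.
have nKG : K <| G by apply: normal_index_pdiv => //; rewrite iK ox.
rewrite (series_sol nKG); apply/andP; split.
  apply: IHn (complemented_group_sub sKG cG).
  rewrite -ltnS; apply: leq_trans leGn.
  by rewrite -(Lagrange sKG) iK ox ltn_Pmulr ?cardG_gt0 // prime_gt1.
apply/abelian_sol/cyclic_abelian/prime_cyclic.
by rewrite card_quotient ?normal_norm // iK ox.
Qed.

(** An element of prime order in the second derived subgroup would lie in a complement of the
    subgroup it generates, as this complement has prime index. *)
Lemma complemented_der2 G : complemented_group G -> G^`(2) = 1.
Proof.
move=> cG; apply/eqP; apply: contraT => G2; rewrite -cardG_gt1 in G2.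
have pr_p := pdiv_prime G2.
have [x Gx ox] := Cauchy pr_p (pdiv_dvd _).
have [|K sKG [iK tiK]] := complemented_cycle cG (_ : x \in G).
  exact: (subsetP (der_sub 2 G)).
have sG2 : G^`(2) \subset K.
  by apply: solvable_prime_index_der2; rewrite ?iK ?ox ?complemented_solvable.
have : x \in <[x]> :&: K by rewrite inE cycle_id (subsetP sG2).
by rewrite tiK => /set1P x1; move: pr_p; rewrite -ox x1 order1.
Qed.

End FiniteComplemented.

(* Imported only now because it redefines [<|]. *)
From mathcomp Require Import all_classical all_reals all_analysis.
Local Open Scope classical_set_scope.

(** * Subgroups and complements *)

Section GroupTheory.
Context {T : topologicalType} (G : topGroup T).
Implicit Types (x y z g h : T) (A D F H K M S : set T).

Local Notation "x * y" := (gmul G x y).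
Local Notation "x ^-1" := (ginv G x).
Local Notation "1" := (gone G).
Local Notation sg := (tg_subgroup G).
Local Notation gen := (tg_generated G).

Lemma tg_mulKV y x : x^-1 * (x * y) = y.
Proof. by rewrite gmulA gmulV gmul1. Qed.

Lemma tg_mulV x : x * x^-1 = 1.
Proof. by rewrite -[LHS](tg_mulKV _ x^-1) (tg_mulKV x^-1 x) gmulV. Qed.

Lemma tg_mul1 x : x * 1 = x.
Proof. by rewrite -(gmulV G x) gmulA tg_mulV gmul1. Qed.

Lemma tg_mulK x y : y * x * x^-1 = y.
Proof. by rewrite -gmulA tg_mulV tg_mul1. Qed.

Lemma tg_mulVK x y : y * x^-1 * x = y.
Proof. by rewrite -gmulA gmulV tg_mul1. Qed.

Lemma tg_mulI x : injective (gmul G x).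
Proof. by move=> y z /(congr1 (gmul G x^-1)); rewrite !tg_mulKV. Qed.

Lemma tg_mulIr x : injective (gmul G ^~ x).
Proof. by move=> y z /(congr1 (gmul G ^~ x^-1)); rewrite /= !tg_mulK. Qed.

Lemma tg_invK x : x^-1^-1 = x.
Proof. by apply: (@tg_mulI x^-1); rewrite tg_mulV gmulV. Qed.

Lemma tg_inv1 : 1^-1 = 1.
Proof. by rewrite -[LHS]tg_mul1 gmulV. Qed.

Lemma tg_invM x y : (x * y)^-1 = y^-1 * x^-1.
Proof. by apply: (@tg_mulI (x * y)); rewrite tg_mulV gmulA tg_mulK tg_mulV. Qed.

(* A confluent rewriting system for the word problem in free groups. *)
Definition tgE := (gmulA, tg_mulK, tg_mulVK, tg_mulV, gmulV, tg_mul1, gmul1,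
  tg_invK, tg_invM, tg_inv1).

Lemma tg_eqV x y : x^-1 * y = 1 -> x = y.
Proof. by move/(congr1 (gmul G x)); rewrite !tgE. Qed.

Lemma tg_subgroup1 H : sg H -> H 1. Proof. by case. Qed.
Lemma tg_subgroupM H x y : sg H -> H x -> H y -> H (x * y).
Proof. by case=> _ [+ _]; apply. Qed.
Lemma tg_subgroupV H x : sg H -> H x -> H x^-1.
Proof. by case=> _ [_ +]; apply. Qed.
Lemma tg_subgroupMl H x y : sg H -> H x -> H (x * y) -> H y.
Proof.
move=> sH Hx Hxy; rewrite -(tg_mulKV y x); apply: tg_subgroupM => //.
exact: tg_subgroupV.
Qed.
Lemma tg_subgroupMr H x y : sg H -> H y -> H (x * y) -> H x.
Proof.
move=> sH Hy Hxy; rewrite -(tg_mulK y x); apply: tg_subgroupM => //.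
exact: tg_subgroupV.
Qed.

Lemma tg_subgroupT : sg setT. Proof. by []. Qed.

Lemma tg_subgroup_trivial : sg [set 1].
Proof.
by split=> //; split=> [x y -> ->|x ->] /=; rewrite !tgE.
Qed.

Lemma tg_subgroupI H K : sg H -> sg K -> sg (H `&` K).
Proof.
move=> sH sK; split; first by split; apply: tg_subgroup1.
split=> [x y [Hx Kx] [Hy Ky]|x [Hx Kx]]; split;
  by [apply: tg_subgroupM | apply: tg_subgroupV].
Qed.

Lemma tg_generated_subgroup M : sg (gen M).
Proof.
split; first by move=> H sH _; apply: tg_subgroup1.
split=> [x y Mx My|x Mx] H sH MH; first by apply: tg_subgroupM; [|apply: Mx|apply: My].
by apply: tg_subgroupV => //; apply: Mx.
Qed.

Lemma tg_generated_sub M : M `<=` gen M.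
Proof. by move=> x Mx H _; apply. Qed.

Lemma tg_generated_min M H : sg H -> M `<=` H -> gen M `<=` H.
Proof. by move=> sH MH x; apply. Qed.

Lemma tg_generated1 x : gen [set x] x.
Proof. exact: tg_generated_sub. Qed.

Lemma tg_generated1_min x H : sg H -> H x -> gen [set x] `<=` H.
Proof. by move=> sH Hx; apply: tg_generated_min => // _ ->. Qed.

Lemma tg_setmulE H K x y : H x -> K y -> tg_setmul G H K (x * y).
Proof. by move=> Hx Ky; exists x, y. Qed.

Lemma tg_setmul_subl H K : sg K -> H `<=` tg_setmul G H K.
Proof.
move=> sK x Hx; exists x, 1; rewrite tgE; split=> //; split=> //.
exact: tg_subgroup1.
Qed.

Lemma tg_setmul_subr H K : sg H -> K `<=` tg_setmul G H K.
Proof.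
by move=> sH x Kx; exists 1, x; rewrite tgE; split=> //; apply: tg_subgroup1.
Qed.

Lemma tg_setmul_subgroup H K : sg H -> sg K ->
  (forall x y, H x -> K y -> H (y^-1 * x * y)) -> sg (tg_setmul G H K).
Proof.
move=> sH sK nHK; split.
  by exists 1, 1; rewrite tgE; split; [|split] => //; apply: tg_subgroup1.
split=> [_ _ [h [k [Hh [Kk ->]]]] [h' [k' [Hh' [Kk' ->]]]]|_ [h [k [Hh [Kk ->]]]]].
  exists (h * (k^-1^-1 * h' * k^-1)), (k * k'); split; last split.
  - by apply: tg_subgroupM => //; apply: nHK => //; apply: tg_subgroupV.
  - exact: tg_subgroupM.
  - by rewrite !tgE.
exists (k^-1 * h^-1 * k), k^-1; split; last split.
- by apply: nHK => //; apply: tg_subgroupV.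
- exact: tg_subgroupV.
- by rewrite !tgE.
Qed.

Definition tg_conj g x := g * x * g^-1.

Lemma tg_conjM g x y : tg_conj g (x * y) = tg_conj g x * tg_conj g y.
Proof. by rewrite /tg_conj !tgE. Qed.

Lemma tg_conjV g x : tg_conj g x^-1 = (tg_conj g x)^-1.
Proof. by rewrite /tg_conj !tgE. Qed.

Lemma tg_conj1 g : tg_conj g 1 = 1.
Proof. by rewrite /tg_conj !tgE. Qed.

Lemma tg_conjMl g h x : tg_conj (g * h) x = tg_conj g (tg_conj h x).
Proof. by rewrite /tg_conj !tgE. Qed.

Lemma tg_conj1l x : tg_conj 1 x = x.
Proof. by rewrite /tg_conj !tgE. Qed.

Lemma tg_conjK g x : tg_conj g^-1 (tg_conj g x) = x.
Proof. by rewrite /tg_conj !tgE. Qed.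

Lemma tg_conjVK g x : tg_conj g (tg_conj g^-1 x) = x.
Proof. by rewrite /tg_conj !tgE. Qed.

Lemma tg_conj_id g x : (tg_conj g x = x) <-> (g * x = x * g).
Proof.
split; rewrite /tg_conj; first by move/(congr1 (gmul G ^~ g)); rewrite /= !tgE.
by move=> ->; rewrite !tgE.
Qed.

Lemma tg_subgroup_conj g H : sg H -> sg [set x | H (tg_conj g x)].
Proof.
move=> sH; split; first by rewrite /= tg_conj1; apply: tg_subgroup1.
split=> [x y|x] /=; rewrite ?tg_conjM ?tg_conjV; first exact: tg_subgroupM.
exact: tg_subgroupV.
Qed.

Lemma tg_generated_conj g M x :
  gen M x -> gen [set tg_conj g y | y in M] (tg_conj g x).
Proof.
move=> /(_ _ (tg_subgroup_conj g (tg_generated_subgroup _))); apply.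
by move=> y My; apply: tg_generated_sub; exists y.
Qed.

Definition tg_normalises S K := forall g x, S g -> K x -> K (tg_conj g x).

Definition tg_commutative A := forall x y, A x -> A y -> x * y = y * x.

Lemma tg_setmul_comm A H K : tg_commutative A -> H `<=` A -> K `<=` A ->
  sg H -> sg K -> sg (tg_setmul G H K).
Proof.
move=> cA HA KA sH sK; apply: tg_setmul_subgroup => // x y Hx Ky.
by rewrite -gmulA (cA x y) ?tgE //; [exact: HA|exact: KA].
Qed.

Lemma tg_subgroup_bigcup (C : set (set T)) : C !=set0 -> C `<=` sg ->
  total_on C subset -> sg (\bigcup_(H in C) H).
Proof.
move=> [H0 CH0] Csg totC; split.
  by exists H0 => //; apply: tg_subgroup1; apply: Csg.
split=> [x y [H CH Hx] [K CK Ky]|x [H CH Hx]]; last first.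
  by exists H => //; apply: tg_subgroupV => //; apply: Csg.
have [HK|KH] := totC _ _ CH CK.
  by exists K => //; apply: tg_subgroupM => //; [apply: Csg|apply: HK].
by exists H => //; apply: tg_subgroupM => //; [apply: Csg|apply: KH].
Qed.

(** Zorn's lemma in the form used for the two maximal choices below; only nonempty chains have to be
    examined, because [H0] takes care of the empty one. *)
Lemma tg_subgroup_Zorn (Q : set (set T)) H0 : sg H0 -> Q H0 ->
  (forall C : set (set T), C !=set0 -> C `<=` sg `&` Q -> total_on C subset ->
    Q (\bigcup_(H in C) H)) ->
  exists H, [/\ sg H, Q H & forall K, sg K -> Q K -> H `<=` K -> K `<=` H].
Proof.
move=> sH0 QH0 chQ.
(* The union of the empty chain is set0, which is not a subgroup. *)
have [|H [PH maxH]] := @Zorn_bigcup _ [set X | X = set0 \/ sg X /\ Q X].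
  move=> C CP totC; have [C0|C0] := pselect (exists2 X, C X & X !=set0); last first.
    left; rewrite -subset0 => x [X CX Xx]; apply: C0.
    by exists X => //; exists x.
  have -> : \bigcup_(X in C) X = \bigcup_(X in C `&` [set X | X !=set0]) X.
    rewrite eqEsubset; split=> x [X].
      by move=> CX Xx; exists X => //; split=> //; exists x.
    by move=> [CX _] Xx; exists X.
  have [X CX X0] := C0.
  have C'0 : C `&` [set X | X !=set0] !=set0 by exists X.
  have C'P : C `&` [set X | X !=set0] `<=` sg `&` Q.
    by move=> Y [/CP [->|//]] [? []].
  have C'tot : total_on (C `&` [set X | X !=set0]) subset.
    by move=> Y Z [CY _] [CZ _]; apply: totC.
  right; split; last exact: chQ.
  by apply: tg_subgroup_bigcup => // Y /C'P[].
case: PH => [H0'|[sH QH]].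
  exfalso; apply: (maxH H0); last by right.
  rewrite H0' properEneq; split=> //; apply/eqP => E.
  by have := tg_subgroup1 sH0; rewrite -E.
exists H; split=> // K sK QK HK; apply: contrapT => nKH.
by apply: (maxH K); [split|right].
Qed.

(* The generators x of those subgroups normalised by S that are simple, and x = 1. *)
Definition tg_minimal S : set T := [set x |
  (forall g, S g -> gen [set x] (tg_conj g x)) /\
  (forall y, gen [set x] y -> y <> 1 -> gen [set y] x)].

Lemma tg_minimal_generated_conj S x y g :
  tg_minimal S x -> S g -> gen [set x] y -> gen [set x] (tg_conj g y).
Proof.
move=> [nx _] Sg xy; have := tg_generated_conj (g := g) xy.
apply: tg_generated_min; first exact: tg_generated_subgroup.
by move=> _ [_ -> <-]; apply: nx.
Qed.

(* Let D be maximal among the subgroups of F containing all minimal elements but not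
   a, let K be a complement of D and write a = d l.  Every nontrivial subgroup of
   K :&: F contains l, which is therefore minimal. *)
Lemma complemented_generated_minimal S F : sg S -> sg F -> F `<=` S ->
  tg_commutative F -> tg_normalises S F ->
  (forall D, sg D -> D `<=` F -> exists K, perm_complement G D K) ->
  F `<=` gen (tg_minimal S `&` F).
Proof.
move=> sS sF FS cF nSF compF a Fa; set M := gen _; apply: contrapT => nMa.
have MF : M `<=` F by apply: tg_generated_min => // x [].
pose Q := [set D | [/\ M `<=` D, D `<=` F & ~ D a]].
have sM : sg M by exact: tg_generated_subgroup.
have QM : Q M by split.
have [|D [sD [MD DF nDa] maxD]] := tg_subgroup_Zorn sM QM.
- move=> C [D0 CD0] CQ _; have [_ [MD0 _ _]] := CQ _ CD0; split.
  + by move=> x Mx; exists D0 => //; apply: MD0.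
  + by move=> x [D /CQ [_ [_ DF _]] Dx]; apply: DF.
  + by move=> [D /CQ [_ [_ _ nDa]] Da]; apply: nDa.
have [K [sK [DKT DK1]]] := compF D sD DF.
have DK x : D x -> K x -> x = 1 by move=> Dx Kx; have : (D `&` K) x by []; rewrite DK1.
have [d [l [Dd [Kl al]]]] : tg_setmul G D K a by rewrite DKT.
have Fl : F l by apply: (tg_subgroupMl sF (DF _ Dd)); rewrite -al.
have l1 : l <> 1 by move=> l1; apply: nDa; rewrite al l1 tg_mul1.
(* Writing g = d' k with d' in [D], the factor d' centralises the abelian group [F], so [g] acts on
   [x] as k does. *)
have nSK g x : S g -> K x -> F x -> K (tg_conj g x).
  move=> Sg Kx Fx; have [d' [k [Dd' [Kk gE]]]] : tg_setmul G D K g by rewrite DKT.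
  have Sk : S k by apply: (tg_subgroupMl sS (FS _ (DF _ Dd'))); rewrite -gE.
  rewrite gE tg_conjMl (_ : tg_conj d' _ = tg_conj k x).
    by apply: tg_subgroupM => //; [apply: tg_subgroupM|apply: tg_subgroupV].
  by apply/tg_conj_id; apply: cF; [apply: DF|apply: nSF].
have l_min y : K y -> F y -> y <> 1 -> gen [set y] l.
  move=> Ky Fy y1.
  have yK := tg_generated1_min sK Ky; have yF := tg_generated1_min sF Fy.
  have sy := tg_generated_subgroup [set y].
  (* If a = d l = d' z with z in <y>, then l z^-1 = d^-1 d' lies in both [K] and [D], so l = z.
     Otherwise D<y> still omits [a], and maximality of [D] puts [y] into [D]. *)
  have [[d' [z [Dd' [yz az]]]]|nDya] := pselect (tg_setmul G D (gen [set y]) a).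
    suff -> : l = z by [].
    apply: (@tg_mulIr z^-1); rewrite tg_mulV; apply: DK; last first.
      by apply: tg_subgroupM => //; apply: tg_subgroupV => //; apply: yK.
    rewrite (_ : l * z^-1 = d^-1 * d'); last first.
      by apply: (@tg_mulI d); apply: (@tg_mulIr z); rewrite !tgE -az.
    by apply: tg_subgroupM => //; apply: tg_subgroupV.
  case: y1; apply: DK => //.
  have sDy : sg (tg_setmul G D (gen [set y])) by apply: (tg_setmul_comm cF).
  apply: (maxD _ sDy); last by apply: tg_setmul_subr => //; apply: tg_generated1.
  - split=> //; first by move=> x /MD; apply: tg_setmul_subl.
    move=> _ [d' [z [Dd' [yz ->]]]].
    by apply: tg_subgroupM => //; [apply: DF|apply: yF].
  - exact: tg_setmul_subl.
apply: (l1); apply: DK => //; apply: MD; apply: tg_generated_sub; split=> //; split.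
  move=> g Sg; have SgV := tg_subgroupV sS Sg.
  have gl1 : tg_conj g^-1 l <> 1.
    by move=> E; apply: l1; rewrite -(tg_conjVK g l) E tg_conj1.
  have := tg_generated_conj (g := g) (l_min _ (nSK _ _ SgV Kl Fl) (nSF _ _ SgV Fl) gl1).
  apply: tg_generated_min; first exact: tg_generated_subgroup.
  by move=> _ [_ -> <-]; rewrite tg_conjVK; apply: tg_generated1.
move=> y ly y1; apply: l_min => //; first exact: (tg_generated1_min sK Kl).
exact: (tg_generated1_min sF Fl).
Qed.

(** Take [K] maximal among the [S]-normalised subgroups of [A] that meet [D] trivially; the two
    cases below show that every minimal element of [A] lies in DK. *)
Lemma generated_minimal_complement S A D : sg S -> sg A ->
  tg_commutative A -> A `<=` gen (tg_minimal S `&` A) -> sg D -> D `<=` A ->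
  exists K, [/\ sg K, K `<=` A, tg_normalises S K,
    A `<=` tg_setmul G D K & D `&` K = [set 1]].
Proof.
move=> sS sA cA genA sD DA.
pose Q := [set K | [/\ K `<=` A, tg_normalises S K & D `&` K `<=` [set 1]]].
have Q1 : Q [set 1].
  split; first by move=> _ ->; apply: tg_subgroup1.
    by move=> g _ _ ->; rewrite tg_conj1.
  by move=> x [].
have [|K [sK [KA nSK DK1] maxK]] := tg_subgroup_Zorn tg_subgroup_trivial Q1.
  move=> C _ CQ _; split.
  + by move=> x [K /CQ [_ [KA _ _]]]; apply: KA.
  + by move=> g x Sg [K CK Kx]; exists K => //; have [_ [_ + _]] := CQ _ CK; apply.
  + by move=> x [Dx [K /CQ [_ [_ _ +]] Kx]]; apply.
exists K; split=> //; last first.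
  by rewrite eqEsubset; split=> // _ ->; split; apply: tg_subgroup1.
have sDK : sg (tg_setmul G D K) by apply: (tg_setmul_comm cA).
move=> x /genA; apply: tg_generated_min => // e [me Ae].
have eA := tg_generated1_min sA Ae.
have se := tg_generated_subgroup [set e].
have sKe : sg (tg_setmul G K (gen [set e])) by apply: (tg_setmul_comm cA).
(* If K<e> still meets [D] trivially, maximality gives e in [K]. Otherwise some d = k z is
   nontrivial with z in <e>; then z is a nontrivial element of DK, and by minimality it generates
   e. *)
have [E|nE] := pselect (D `&` tg_setmul G K (gen [set e]) `<=` [set 1]).
  apply: tg_setmul_subr => //; apply: (maxK (tg_setmul G K (gen [set e]))) => //.
  - split=> //.
      move=> _ [k [z [Kk [ez ->]]]].
      by apply: tg_subgroupM => //; [apply: KA|apply: eA].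
    move=> g _ Sg [k [z [Kk [ez ->]]]]; rewrite tg_conjM; apply: tg_setmulE.
      exact: nSK.
    exact: (tg_minimal_generated_conj me).
  - exact: tg_setmul_subl.
  - by apply: tg_setmul_subr => //; apply: tg_generated1.
have [d [Dd [k [z [Kk [ez dE]]]]] d1] :
    exists2 d, (D `&` tg_setmul G K (gen [set e])) d & d <> 1.
  apply: contrapT => nd; apply: nE => d dP; apply: contrapT => d1.
  by apply: nd; exists d.
have z1 : z <> 1.
  by move=> z1; apply: d1; apply: DK1; split=> //; rewrite dE z1 tg_mul1.
have DKz : tg_setmul G D K z.
  rewrite (_ : z = d * k^-1); last first.
    have Ak := KA _ Kk; have Az := eA _ ez.
    by rewrite dE (cA _ _ Ak Az) tg_mulK.
  by apply: tg_setmulE => //; apply: tg_subgroupV.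
by apply: (tg_generated1_min sDK DKz); case: me => _; apply.
Qed.

End GroupTheory.

(** * Torsion and the assembly of complements *)

Section Complements.
Context {T : topologicalType} (G : topGroup T).
Implicit Types (x y z g h : T) (A B D F H K M S : set T).

Local Notation "x * y" := (gmul G x y).
Local Notation "x ^-1" := (ginv G x).
Local Notation "1" := (gone G).
Local Notation sg := (tg_subgroup G).
Local Notation gen := (tg_generated G).

Lemma gexpD x m n : gexp G x (m + n) = gexp G x m * gexp G x n.
Proof. by elim: m => [|m IHm]; rewrite ?gmul1 //= IHm gmulA. Qed.

Lemma gexp_eq1_mul x m n : gexp G x m = 1 -> gexp G x (n * m) = 1.
Proof. by move=> xm; elim: n => // n IHn; rewrite mulSn gexpD xm IHn gmul1. Qed.

Lemma finite_cycle x n : (0 < n)%N -> gexp G x n = 1 -> finite_set (gen [set x]).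
Proof.
move=> n0 xn; apply: (@sub_finite_set _ _ (gexp G x @` `I_n)); last first.
  exact/finite_image/finite_II.
have redn m : (gexp G x @` `I_n) (gexp G x m).
  exists (m %% n)%N; first exact: ltn_pmod.
  by rewrite [in RHS](divn_eq m n) gexpD gexp_eq1_mul // gmul1.
apply: tg_generated_min; last by move=> _ ->; have := redn 1%N; rewrite /= tg_mul1.
split; first exact: (redn 0%N).
split=> [_ _ [i _ <-] [j _ <-]|_ [i _ <-]]; first by rewrite -gexpD.
(* As x^n = 1, the inverse of x^i is x^(i(n-1)). *)
rewrite (_ : _^-1 = gexp G x (i * n.-1)%N); first exact: redn.
apply: (@tg_mulI _ G (gexp G x i)).
by rewrite tg_mulV -gexpD -mulnS prednK // gexp_eq1_mul.
Qed.

Lemma finite_setmul H K : finite_set H -> finite_set K -> finite_set (tg_setmul G H K).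
Proof.
move=> fH fK; apply: (@sub_finite_set _ _ [set x * y | x in H & y in K]).
  by move=> _ [h [k [Hh [Kk ->]]]]; exists h => //; exists k.
exact: finite_image2.
Qed.

Lemma finite_generated_abelian A M : tg_torsion G -> sg A ->
  tg_commutative G A -> finite_set M -> M `<=` A -> finite_set (gen M).
Proof.
move=> torG sA cA /finite_seqP[s ->] MA.
suff [F [sF FA finF sub_F]] :
    exists F, [/\ sg F, F `<=` A, finite_set F & [set` s] `<=` F].
  exact: sub_finite_set (tg_generated_min sF sub_F) finF.
elim: s MA => [|x s IHs] MA.
  exists [set 1]; split=> //; first exact: tg_subgroup_trivial.
  by move=> _ ->; apply: tg_subgroup1.
have [F [sF FA finF sF_s]] :
    exists F, [/\ sg F, F `<=` A, finite_set F & [set` s] `<=` F].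
  by apply: IHs => y sy; apply: MA; rewrite /= inE sy orbT.
have Ax : A x by apply: MA; rewrite /= inE eqxx.
have xA := tg_generated1_min sA Ax; have sx := tg_generated_subgroup G [set x].
exists (tg_setmul G (gen [set x]) F); split.
- exact: (tg_setmul_comm cA).
- by move=> _ [y [z [xy [Fz ->]]]]; apply: tg_subgroupM => //; [apply: xA|apply: FA].
- by apply: finite_setmul => //; have [n [n0 xn]] := torG x; apply: finite_cycle n0 xn.
- move=> y; rewrite /= inE => /orP[/eqP->|sy].
    by apply: tg_setmul_subl => //; apply: tg_generated1.
  by apply: tg_setmul_subr => //; apply: sF_s.
Qed.

(* A complement of <x^2> contains k = h^-1 x for some h in <x^2>; as k^2 lies in
   <x^2>, it is trivial, so x^2 = h^2 is a power of x with exponent divisible by 4. *)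
Lemma C_group_torsion : C_group G -> tg_torsion G.
Proof.
move=> CG x; pose P m := gexp G x m.
(* This is <x^2>: the equation says y = x^(2(j-i)), written with natural exponents only. *)
pose H := [set y | y * x = x * y /\ exists i j, y * P (i.*2) = P (j.*2)].
have comP y i : y * x = x * y -> y * P i = P i * y.
  move=> yx; elim: i => [|i IHi]; rewrite /P /= ?tgE // yx -gmulA.
  by rewrite -/(P i) IHi gmulA.
have sH : sg H.
  split; first by split; [rewrite !tgE | exists 0%N, 0%N; rewrite gmul1].
  split=> [y z [yx [i [j yE]]] [zx [k [l zE]]]|y [yx [i [j yE]]]].
    split; first by rewrite -gmulA zx gmulA yx gmulA.
    exists (i + k)%N, (j + l)%N; rewrite !doubleD /P !gexpD -!/(P _).
    by rewrite gmulA -(gmulA G y) (comP z) // gmulA yE -gmulA zE.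
  split; first by apply: (@tg_mulI _ G y); apply: (@tg_mulIr _ G y); rewrite !tgE yx.
  by exists j, i; rewrite -yE !tgE.
have [K [sK [HKT HK1]]] := CG H sH.
have [h [k [Hh [Kk xE]]]] : tg_setmul G H K x by rewrite HKT.
have [hx [i [j hE]]] := Hh.
have kk : k * k = (h * h)^-1 * (x * x).
  have hVx : h^-1 * x = x * h^-1.
    by apply: (@tg_mulI _ G h); apply: (@tg_mulIr _ G h); rewrite !tgE hx.
  have -> : k = h^-1 * x by rewrite xE !tgE.
  by rewrite gmulA -(gmulA G h^-1 x) -hVx !tgE.
have xx : x * x = h * h.
  apply/esym/(@tg_eqV _ G).
  have : (H `&` K) (k * k) by split; [rewrite kk|exact: tg_subgroupM] => //;
    apply: tg_subgroupM => //; [apply: tg_subgroupV => //; apply: tg_subgroupM|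
      split; [rewrite gmulA|exists 0%N, 1%N; rewrite /P /= !tgE]].
  by rewrite HK1 kk.
have E : P (2 + (i.*2 + i.*2))%N = P (j.*2 + j.*2)%N.
  rewrite /P !gexpD -!/(P _) {1}/P /= tg_mul1 xx -hE.
  by rewrite !gmulA -[h * _ * h]gmulA -(comP h) ?gmulA.
have [lt_ij|gt_ij|] := ltngtP (2 + (i.*2 + i.*2))%N (j.*2 + j.*2)%N.
- exists (j.*2 + j.*2 - (2 + (i.*2 + i.*2)))%N; rewrite subn_gt0; split=> //.
  apply: (@tg_mulI _ G (P (2 + (i.*2 + i.*2))%N)).
  by rewrite -gexpD subnKC ?tg_mul1 // ltnW.
- exists (2 + (i.*2 + i.*2) - (j.*2 + j.*2))%N; rewrite subn_gt0; split=> //.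
  apply: (@tg_mulI _ G (P (j.*2 + j.*2)%N)).
  by rewrite -gexpD subnKC ?tg_mul1 // ltnW.
(* Equal exponents would give 2 + 4i = 4j, and halving yields an odd number equal to an even one. *)
- rewrite !addnn add2n -doubleS => /double_inj /(congr1 odd).
  by rewrite /= !odd_double.
Qed.

(** The complement of [H] is A1 B1, where [A1] complements H & A in [A] and is normal in [G], and
    [B1] complements AH & B in [B]. *)
Lemma C_group_semidirect A B : sg A -> sg B -> tg_normalises G setT A ->
  tg_setmul G A B = setT -> A `&` B = [set 1] ->
  (forall D, sg D -> D `<=` A -> exists K, [/\ sg K, K `<=` A,
     tg_normalises G setT K, A `<=` tg_setmul G D K & D `&` K = [set 1]]) ->
  (forall D, sg D -> D `<=` B -> exists K, [/\ sg K, K `<=` B,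
     B `<=` tg_setmul G D K & D `&` K = [set 1]]) ->
  C_group G.
Proof.
move=> sA sB nA ABT AB1 compA compB H sH.
have nV K x y : tg_normalises G setT K -> K x -> K (y^-1 * x * y).
  by move=> nK Kx; have := nK y^-1 x I Kx; rewrite /tg_conj tg_invK.
have sAH : sg (tg_setmul G A H) by apply: tg_setmul_subgroup => // x y Ax _; apply: nV.
have [A1 [sA1 A1A nA1 AE HA1]] := compA _ (tg_subgroupI sH sA) (@subIsetr _ _ _).
have [B1 [sB1 B1B BE HB1]] := compB _ (tg_subgroupI sAH sB) (@subIsetr _ _ _).
exists (tg_setmul G A1 B1); split.
  by apply: tg_setmul_subgroup => // x y ? _; apply: nV.
split.
  rewrite -subTset => g _.
  have [a [b [Aa [Bb ->]]]] : tg_setmul G A B g by rewrite ABT.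
  (* With b = a' h b1, the element g = a b equals h (h^-1 a a' h) b1; the bracket lies in [A] and
     splits as d a1 with d in [H]. *)
  have [_ [b1 [[[a' [h [Aa' [Hh ->]]]] _] [B1b1 ->]]]] := BE _ Bb.
  have [d [a1 [[Hd _] [A1a1 E]]]] : tg_setmul G (H `&` A) A1 (h^-1 * (a * a') * h).
    by apply: AE; apply: nV => //; apply: tg_subgroupM.
  exists (h * d), (a1 * b1); split; first exact: tg_subgroupM.
  split; first exact: tg_setmulE.
  by rewrite !gmulA -(gmulA G h d a1) -E !tgE.
rewrite eqEsubset; split; last first.
  move=> _ ->; split; first exact: tg_subgroup1.
  by exists 1, 1; rewrite gmul1; split; [|split] => //; apply: tg_subgroup1.
move=> x [Hx [a1 [b1 [A1a1 [B1b1 xE]]]]].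
(* If x = a1 b1 lies in [H], then b1 = a1^-1 x lies in AH & B as well as in [B1]. *)
have b11 : b1 = 1.
  have : ((tg_setmul G A H `&` B) `&` B1) b1; last by rewrite HB1.
  split=> //; split; last exact: B1B.
  exists a1^-1, x; split; first by apply: tg_subgroupV => //; apply: A1A.
  by split=> //; rewrite xE !tgE.
rewrite xE b11 tg_mul1 in Hx *.
have : ((H `&` A) `&` A1) a1; last by rewrite HA1.
by split=> //; split=> //; apply: A1A.
Qed.

(** Each [a] lies in the subgroup generated by its finite [S]-class, which is finite because [A] is
    abelian and torsion. Its subgroups are finite, hence closed, hence complemented in [G], so it is
    generated by minimal elements. *)
Lemma profinite_C_torsion_complement S A : profinite_C_group G -> tg_torsion G ->
  sg S -> sg A -> A `<=` S -> tg_commutative G A -> tg_normalises G S A ->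
  (forall a, A a -> finite_set [set tg_conj G g a | g in S]) ->
  forall D, sg D -> D `<=` A -> exists K, [/\ sg K, K `<=` A,
    tg_normalises G S K, A `<=` tg_setmul G D K & D `&` K = [set 1]].
Proof.
move=> [[_ [hT _]] CG] torG sS sA AS cA nSA finA D sD DA.
apply: (generated_minimal_complement sS sA cA) => // a Aa.
pose X := [set tg_conj G g a | g in S].
have XA : X `<=` A by move=> _ [g Sg <-]; apply: nSA.
have sX := tg_generated_subgroup G X; have genXA := tg_generated_min sA XA.
have finX : finite_set (gen X).
  by apply: (finite_generated_abelian torG sA cA) => //; apply: finA.
have : gen (tg_minimal G S `&` gen X) a; last first.
  apply: tg_generated_min; first exact: tg_generated_subgroup.
  by move=> x [mx Xx]; apply: tg_generated_sub; split=> //; apply: genXA.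
apply: (complemented_generated_minimal sS sX).
- exact: subset_trans AS.
- by move=> x y /genXA Ax /genXA Ay; apply: cA.
- move=> g x Sg Xx; have := tg_generated_conj (g := g) Xx.
  apply: tg_generated_min => // _ [_ [h Sh <-] <-]; rewrite -tg_conjMl.
  by apply: tg_generated_sub; exists (g * h) => //; apply: tg_subgroupM.
- move=> E sE EX; have [|K [_ KE]] := CG E sE; last by exists K.
  apply: (iffLR accessible_finite_set_closed (hausdorff_accessible hT)).
  exact: sub_finite_set EX finX.
- by apply: tg_generated_sub; exists 1; [apply: tg_subgroup1|rewrite tg_conj1l].
Qed.

End Complements.

(** * Profinite groups *)

(* The intersection Q of the clopen neighbourhoods of x is connected. *)
Lemma compact_totally_disconnected_zero_dimensional (T : topologicalType) :
  compact [set: T] -> hausdorff_space T -> totally_disconnected [set: T] ->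
  zero_dimensional T.
Proof.
move=> cT hT tdT x y xy; apply: contrapT => nsep.
pose Q := \bigcap_(C in [set C : set T | clopen C /\ C x]) C.
have Qx : Q x by move=> C [_].
have Qy : Q y.
  move=> C [clC Cx]; apply: contrapT => nCy; apply: nsep.
  by exists C.
have clQ : closed Q by apply: closed_bigI => C [[]].
(* A partition of [Q] into two closed pieces is trivial. Normality gives an open [U] around [E1]
   whose closure misses [E2], so that [Q] misses the boundary of [U]. *)
have split_Q E1 E2 : closed E1 -> closed E2 -> Q = E1 `|` E2 ->
    E1 `&` E2 = set0 -> E1 x -> E2 = set0.
  move=> cE1 cE2 QE E12 E1x.
  have : set_nbhs E1 (~` E2).
    apply/set_nbhsP; exists (~` E2); split => //; first exact: closed_openC.
    by apply/disjoints_subset.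
  move=> /(compact_normal hT cT cE1)[V /set_nbhsP[U [oU E1U UV]] clV].
  have UE2 : closure U `<=` ~` E2 by apply: subset_trans clV; apply: closureS.
  pose K := closure U `&` ~` U.
  have cK : compact K.
    apply: subclosed_compact cT _ => //; apply: closedI; first exact: closed_closure.
    exact: open_closedC.
  (* Otherwise the traces on [K] of the clopen neighbourhoods of [x] form a proper filter, with a
     cluster point in both [Q] and [K]. *)
  have [D [clD Dx] DK] : exists2 D, clopen D /\ D x & D `&` K = set0.
    apply: contrapT => nD.
    pose F := filter_from [set C : set T | clopen C /\ C x] (fun D => D `&` K).
    have FF : Filter F.
      apply: filter_from_filter; first by exists setT; split=> //; apply: clopenT.
      move=> C D [clC Cx] [clD Dx]; exists (C `&` D).
        by split=> //; apply: clopenI.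
      by move=> z [[Cz Dz] Kz].
    have PF : ProperFilter F.
      apply: filter_from_proper => C Cx; apply: contrapT => /set0P/negP/negPn/eqP C0.
      by apply: nD; exists C.
    have FK : F K by exists setT; [split=> //; exact: clopenT|move=> z []].
    have [z [Kz Fz]] := cK F PF FK.
    have Qz : Q z.
      move=> C [[oC cC] Cx]; apply: (cC) => B Bz.
      have FCK : F (C `&` K) by exists C.
      by have [w [[Cw _] Bw]] := Fz _ B FCK Bz; exists w.
    have [clUz nUz] := Kz; move: Qz; rewrite QE => -[/E1U//|E2z].
    exact: UE2 E2z.
  (* Since [D] misses the boundary of [U], intersecting it with [U] or with its closure gives the
     same set; this set is clopen and contains [x], hence contains [Q]. *)
  have clDU : clopen (D `&` U).
    split; first by apply: openI => //; case: clD.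
    rewrite (_ : D `&` U = D `&` closure U).
      by apply: closedI; [case: clD|exact: closed_closure].
    rewrite eqEsubset; split=> z [Dz Uz]; split=> //; first exact: subset_closure.
    apply: contrapT => nUz; have : (D `&` K) z by [].
    by rewrite DK.
  rewrite -subset0 => z E2z.
  have [_ Uz] : (D `&` U) z.
    have Qz : Q z by rewrite QE; right.
    by apply: Qz; split=> //; split=> //; apply: E1U.
  exact: (UE2 _ (subset_closure Uz)).
suff : connected Q.
  move=> /(connected_component_max Qx (@subsetT _ _)) /(_ _ Qy).
  by rewrite tdT // => /esym/eqP; rewrite (negbTE xy).
move=> B [b Bb] [V oV BV] [C cC BC].
have clB : closed B by rewrite BC; apply: closedI.
pose B' := Q `&` ~` V.
have clB' : closed B' by apply: closedI => //; exact: open_closedC.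
have BB' : B `&` B' = set0 by rewrite BV -subset0 => z [[_ Vz] [_ nVz]].
have QE : Q = B `|` B' by rewrite BV -setIUr setUv setIT.
have [Bx|nBx] := pselect (B x).
  by rewrite QE (split_Q B B') // setU0.
have B'x : B' x by move: Qx; rewrite {1}QE => -[].
have B0 : B = set0 by apply: (split_Q B' B) => //; [rewrite setUC|rewrite setIC].
by move: Bb; rewrite B0.
Qed.

Section TopologicalGroup.
Context {T : topologicalType} (G : topGroup T).
Implicit Types (x y z g h : T) (A B D F H K M N S : set T).

Local Notation "x * y" := (gmul G x y).
Local Notation "x ^-1" := (ginv G x).
Local Notation "1" := (gone G).
Local Notation sg := (tg_subgroup G).
Local Notation gen := (tg_generated G).

Lemma tg_cvgM (I : Type) (F : set_system I) (FF : Filter F) (u v : I -> T) x y :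
  u @ F --> x -> v @ F --> y -> u i * v i @[i --> F] --> x * y.
Proof.
by move=> ux vy; apply: continuous2_cvg ux vy; apply: (@gmul_cont _ G (x, y)).
Qed.

Lemma tg_cvgV (I : Type) (F : set_system I) (FF : Filter F) (u : I -> T) x :
  u @ F --> x -> (u i)^-1 @[i --> F] --> x^-1.
Proof. by move=> ux; apply: continuous_cvg ux; apply: ginv_cont. Qed.

Lemma tg_continuousM (X : topologicalType) (u v : X -> T) :
  continuous u -> continuous v -> continuous (fun i => u i * v i).
Proof. by move=> cu cv i; apply: tg_cvgM; [apply: cu|apply: cv]. Qed.

Lemma tg_continuousV (X : topologicalType) (u : X -> T) :
  continuous u -> continuous (fun i => (u i)^-1).
Proof. by move=> cu i; apply: tg_cvgV; apply: cu. Qed.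

Lemma tg_continuousMl x : continuous (gmul G x).
Proof. by apply: tg_continuousM => ?; [exact: cvg_cst|exact: cvg_id]. Qed.

Lemma tg_continuousMr x : continuous (gmul G ^~ x).
Proof. by apply: tg_continuousM => ?; [exact: cvg_id|exact: cvg_cst]. Qed.

Lemma tg_continuous_conj g : continuous (tg_conj G g).
Proof.
apply: (tg_continuousM (u := gmul G g) (v := cst g^-1)) => ?; last exact: cvg_cst.
exact: tg_continuousMl.
Qed.

Lemma tg_continuous_conjl x : continuous (tg_conj G ^~ x).
Proof.
apply: (tg_continuousM (u := gmul G ^~ x)); first exact: tg_continuousMr.
exact: ginv_cont.
Qed.

Lemma tg_closed_eq (u v : T -> T) : hausdorff_space T ->
  continuous u -> continuous v -> closed [set x | u x = v x].
Proof.
move=> hT cu cv; rewrite (_ : mkset _ = (fun x => (u x)^-1 * v x) @^-1` [set 1]).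
  apply: preimage_closed => [x _|].
    by apply: tg_continuousM => //; apply: tg_continuousV.
  exact/accessible_closed_set1/hausdorff_accessible.
by rewrite eqEsubset; split=> x /= => [->|/tg_eqV//]; rewrite tgE.
Qed.

(** This carries algebraic properties over to closures, one variable at a time. *)
Lemma closure_min_preimage (u : T -> T) H K : continuous u -> closed K ->
  (forall x, H x -> K (u x)) -> forall x, closure H x -> K (u x).
Proof.
move=> cu cK HK x; rewrite closureE => Hx; apply: (Hx (u @^-1` K)); split=> //.
by apply: preimage_closed => // y _; apply: cu.
Qed.

Lemma closure_subgroup H : sg H -> sg (closure H).
Proof.
move=> sH; have clH := @closed_closure _ H; split.
  by apply: subset_closure; apply: tg_subgroup1.
split=> [x y Hx Hy|x]; last first.
  apply: closure_min_preimage => //; first exact: ginv_cont.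
  by move=> z Hz; apply: subset_closure; apply: tg_subgroupV.
move: x Hx; apply: closure_min_preimage => //; first exact: tg_continuousMr.
move=> x Hx; move: y Hy.
apply: closure_min_preimage => //; first exact: tg_continuousMl.
by move=> y Hy; apply: subset_closure; apply: tg_subgroupM.
Qed.

Lemma closure_commutative H : hausdorff_space T ->
  tg_commutative G H -> tg_commutative G (closure H).
Proof.
move=> hT cH x y Hx Hy.
have clC z : closed [set t | t * z = z * t].
  by apply: tg_closed_eq => //; [exact: tg_continuousMr|exact: tg_continuousMl].
have subC z : (forall t, H t -> t * z = z * t) ->
    forall t, closure H t -> t * z = z * t.
  by move=> cz; rewrite closureE; apply: (smallest_sub (clC z)).
apply: (subC y) Hx => z Hz; apply/esym; apply: (subC z) Hy => t Ht.
exact: cH.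
Qed.

Lemma closure_normalises S H : tg_normalises G S H -> tg_normalises G S (closure H).
Proof.
move=> nH g x Sg; apply: closure_min_preimage; first exact: tg_continuous_conj.
  exact: closed_closure.
by move=> y Hy; apply: subset_closure; apply: nH.
Qed.

Lemma nbhs1_translate x H : nbhs 1 H -> nbhs x [set y | H (x^-1 * y)].
Proof.
move=> nH; have : gmul G x^-1 @ x --> x^-1 * x by exact: tg_continuousMl.
by rewrite gmulV; apply.
Qed.

Lemma closed_subgroup_nbhs1 H : sg H -> nbhs 1 H -> closed H.
Proof.
move=> sH nH x /(_ _ (nbhs1_translate x nH))[y [Hy /= Hxy]].
by rewrite -(tg_invK G x); apply: tg_subgroupV => //; apply: (tg_subgroupMr sH Hy).
Qed.

Lemma compact_coset_representatives H : compact [set: T] -> sg H -> nbhs 1 H ->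
  exists s : seq T, forall x, exists2 r, r \in s & H (r^-1 * x).
Proof.
move=> /compact_near_coveringP cT sH nH.
(* Finite lists are filtered by inclusion: each point asks for itself in the list, and compactness
   gives one list that serves all points. *)
pose F := filter_from [set: seq T] 
  (fun s => [set t : seq T | {subset s <= t}]).
have FF : Filter F.
  apply: filter_from_filter; first by exists [::].
  move=> s t _ _; exists (s ++ t) => // u su.
  by split=> x xs; apply: su; rewrite mem_cat xs ?orbT.
have [|s _ sT] := cT _ F (fun s x => exists2 r, r \in s & H (r^-1 * x)) FF.
  move=> x _; exists ([set y | H (x^-1 * y)], [set s | x \in s]) => /=.
    split; first exact: nbhs1_translate.
    by exists [:: x] => // t xt; apply: xt; rewrite inE.
  by move=> [y s] [/= Hy sx]; exists x.
by exists s => x; apply: (sT s).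
Qed.

Lemma compact_finite_index H : compact [set: T] -> sg H -> nbhs 1 H ->
  tg_finite_index G H.
Proof.
move=> cT sH nH; have [s sE] := compact_coset_representatives cT sH nH.
apply: (@sub_finite_set _ _ ((fun g => [set g * h | h in H]) @` [set` s])).
  move=> _ [g _ <-]; have [r rs Hr] := sE g; exists r => //.
  rewrite eqEsubset; split=> _ [h Hh <-].
    exists (g^-1 * r * h); last by rewrite !tgE.
    by apply: tg_subgroupM => //; have := tg_subgroupV sH Hr; rewrite !tgE.
  by exists (r^-1 * g * h); [apply: tg_subgroupM|rewrite !tgE].
exact/finite_image/finite_seq.
Qed.

(* N is the kernel of the action of G by right translations on the set of right
   translates of a clopen neighbourhood W of 1. *)
Lemma profinite_open_normal U : @tg_profinite T -> nbhs 1 U ->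
  exists N, [/\ sg N, nbhs 1 N, tg_normalises G setT N & N `<=` U].
Proof.
move=> [cT [hT tdT]] U1.
have zT := compact_totally_disconnected_zero_dimensional cT hT tdT.
have [W [W1 clW] WU] := zero_dimensional_cvg hT zT cT U1.
pose N := [set x | forall g w, W w <-> W (w * tg_conj G g x)].
exists N; split; last first.
- move=> x Nx; apply: WU; have := Nx 1 1; rewrite gmul1 tg_conj1l.
  by move=> <-.
- by move=> h x _ Nx g w; rewrite -tg_conjMl.
(* For a fixed pair (g, w) the condition defining [N] holds for x near 1, locally uniformly in (g,
   w); compactness of the square makes it uniform. *)
- have cTT : compact [set: T * T].
    by rewrite -setXTT; apply: compact_setX.
  have near_W (V : set T) (p : T * T) : clopen V -> V p.2 ->
      \forall q \near p & x \near nbhs 1, V q.2 /\ V (q.2 * tg_conj G q.1 x).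
    move=> [oV _] Vp; apply: filterI.
      exists (snd @^-1` V, setT) => /=; last by move=> [q x] [].
      split; last exact: filterT.
      by apply: (@cvg_snd _ _ (nbhs p.1) (nbhs p.2)); exact: open_nbhs_nbhs.
    have : (q.1.2 * tg_conj G q.1.1 q.2) @[q --> (p, 1)] --> p.2 * (p.1 * 1 * p.1^-1).
      have c1 : q.1.1 @[q --> (p, 1)] --> p.1.
        exact: (cvg_comp _ _ cvg_fst cvg_fst).
      have c2 : q.1.2 @[q --> (p, 1)] --> p.2.
        exact: (cvg_comp _ _ cvg_fst cvg_snd).
      apply: tg_cvgM c2 _; apply: tg_cvgM; last exact: tg_cvgV.
      by apply: tg_cvgM => //; exact: cvg_snd.
    by rewrite !tgE => /(_ V); apply; exact: open_nbhs_nbhs.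
  have covW p : [set: T * T] p ->
      \forall q \near p & x \near nbhs 1, W q.2 <-> W (q.2 * tg_conj G q.1 x).
    move=> _; have [Wp|nWp] := pselect (W p.2).
      by apply: filterS (near_W W p clW Wp) => -[q x] /= [].
    have clW' : clopen (~` W) by exact: clopenC.
    apply: filterS (near_W (~` W) p clW' nWp) => -[q x] /= [nq nqx].
    by split=> [/nq|/nqx].
  move/compact_near_coveringP: cTT => /(_ T (nbhs 1) _ _ covW).
  by apply: filterS => x Nx g w; apply: (Nx (g, w)).
- split; first by move=> g w; rewrite tg_conj1 tg_mul1.
  split=> [x y Nx Ny g w|x Nx g w]; first by rewrite tg_conjM gmulA -Ny -Nx.
  by rewrite [X in _ <-> X](Nx g) tg_conjV tg_mulVK.
Qed.

End TopologicalGroup.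

(** * Finite quotients and the derived subgroup *)

Section Quotient.
Context {T : topologicalType} (G : topGroup T).
Implicit Types (x y z g h : T) (A B D F H K M N S : set T).

Local Notation "x * y" := (gmul G x y).
Local Notation "x ^-1" := (ginv G x).
Local Notation "1" := (gone G).
Local Notation sg := (tg_subgroup G).
Local Notation gen := (tg_generated G).

(* G acts on the cosets of N by right multiplication. *)
Lemma finite_index_perm_morphism N (s : seq T) :
  sg N -> tg_normalises G setT N ->
  (forall x, exists2 r, r \in s & N (r^-1 * x)) ->
  exists (X : finType) (phi : T -> {perm X}),
    (forall x y, phi (x * y) = (phi x * phi y)%g) /\ (forall x, phi x = 1%g <-> N x).
Proof.
move=> sN nN sT.
have nNV x y : N x -> N (y^-1 * x * y).
  by move=> Nx; have := nN y^-1 x Logic.I Nx; rewrite /tg_conj tg_invK.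
(* [idx x] is the position of the first entry of [s] in the coset xN, so it depends on that coset
   only. *)
pose idx x := find (fun r => `[< N (r^-1 * x) >]) s.
have idxP x : N ((nth 1 s (idx x))^-1 * x).
  apply/asboolP; apply: (@nth_find _ 1 (fun r => `[< N (r^-1 * x) >])).
  by have [r rs Nr] := sT x; apply/hasP; exists r => //; apply/asboolP.
have idx_lt x : (idx x < size s)%N.
  rewrite -has_find; have [r rs Nr] := sT x.
  by apply/hasP; exists r => //; apply/asboolP.
have idxE x y : idx x = idx y <-> N (x^-1 * y).
  split=> [E|Nxy].
    have := tg_subgroupM sN (tg_subgroupV sN (idxP x)) (idxP y).
    by rewrite E !tgE.
  apply: eq_find => r; apply/asboolP/asboolP => Nr.
    by have := tg_subgroupM sN Nr Nxy; rewrite !tgE.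
  by have := tg_subgroupM sN Nr (tg_subgroupV sN Nxy); rewrite !tgE.
(* Several entries of [s] may represent one coset; keeping the values of [idx] only puts [X] in
   bijection with the cosets. *)
pose X := {i : 'I_(size s) | `[< exists x, idx x = i >]}.
have cP x : `[< exists y, idx y = Ordinal (idx_lt x) >] by apply/asboolP; exists x.
pose c x : X := exist _ (Ordinal (idx_lt x)) (cP x).
have cE x y : c x = c y <-> N (x^-1 * y).
  rewrite -idxE; split=> [[]//|E].
  by apply: val_inj; apply: val_inj.
have rep_ex (q : X) : exists x, c x = q.
  case: q => i qi; have /asboolP[x xi] := qi; exists x.
  by apply: val_inj; apply: val_inj.
have [rep repK] : {rep : X -> T | forall q, c (rep q) = q}.
  exists (fun q => projT1 (cid (rep_ex q))) => q.
  exact: (projT2 (cid (rep_ex q))).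
(* Normality of [N] makes right multiplication well defined on its left cosets. *)
have cMr x y g : c x = c y -> c (x * g) = c (y * g).
  by move=> /cE Nxy; apply/cE; have := nNV _ g Nxy; rewrite !tgE.
pose act g q := c (rep q * g).
have actM g h q : act h (act g q) = act (g * h) q.
  by rewrite /act gmulA; apply: cMr; rewrite repK.
have act1 q : act 1 q = q by rewrite /act tg_mul1 repK.
have act_inj g : injective (act g).
  by move=> q r /(congr1 (act g^-1)); rewrite !actM tg_mulV !act1.
exists X, (fun g => perm (act_inj g)); split.
  by move=> x y; apply/permP => q; rewrite permM !permE actM.
move=> x; split=> [/permP/(_ (c 1))|Nx].
  rewrite permE perm1 /act => E.
  have /cE := etrans (cMr _ _ x (esym (repK (c 1)))) E.
  by rewrite gmul1 tg_mul1 => Nx; rewrite -(tg_invK G x); apply: tg_subgroupV.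
apply/permP => q; rewrite permE perm1 -[RHS]repK; apply/cE.
by rewrite tg_invM -gmulA gmulV tg_mul1; apply: tg_subgroupV.
Qed.

Lemma tg_morphism1 (gT : finGroupType) (phi : T -> gT) :
  (forall x y, phi (x * y) = (phi x * phi y)%g) -> phi 1 = 1%g.
Proof. by move=> phiM; apply: (mulgI (phi 1)); rewrite -phiM mulg1 gmul1. Qed.

Lemma tg_morphismV (gT : finGroupType) (phi : T -> gT) :
  (forall x y, phi (x * y) = (phi x * phi y)%g) -> forall x, phi x^-1 = ((phi x)^-1)%g.
Proof.
by move=> phiM x; apply: (mulgI (phi x)); rewrite -phiM tg_mulV mulgV tg_morphism1.
Qed.

Lemma tg_morphism_image (gT : finGroupType) (phi : T -> gT) H :
  (forall x y, phi (x * y) = (phi x * phi y)%g) -> sg H ->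
  exists P : {group gT}, forall s, s \in P <-> exists2 x, H x & phi x = s.
Proof.
move=> phiM sH; pose P := [set s : gT | `[< exists2 x, H x & phi x = s >]]%SET.
have gP : group_set P.
  apply/group_setP; split.
    by rewrite !inE; exists 1; [apply: tg_subgroup1|apply: tg_morphism1].
  move=> s t; rewrite !inE => -[x Hx xs] [y Hy yt].
  exists (x * y); first exact: tg_subgroupM.
  by rewrite phiM xs yt.
by exists (group gP) => s; rewrite !inE.
Qed.

(** The preimage [H] of [Q] is open, hence closed. It contains the kernel, so the image of a
    complement of [H] meets [Q] trivially. *)
Lemma profinite_C_quotient_complemented (gT : finGroupType) (phi : T -> gT)
    (P : {group gT}) : profinite_C_group G ->
  (forall x y, phi (x * y) = (phi x * phi y)%g) -> nbhs 1 [set x | phi x = 1%g] ->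
  (forall s, s \in P <-> exists2 x, setT x & phi x = s) ->
  complemented_group P.
Proof.
move=> [_ CG] phiM kerphi PP Q sQP.
pose H := [set x | phi x \in Q].
have sH : sg H.
  split; first by rewrite /H /= tg_morphism1.
  split=> [x y|x] /=; first by rewrite /H /= phiM; exact: groupM.
  by rewrite /H /= tg_morphismV // groupV.
have clH : closed H.
  apply: closed_subgroup_nbhs1 sH _; apply: filterS kerphi => x x1.
  by rewrite /H /= x1 group1.
have [K [_ [sK [HKT HK1]]]] := CG H sH clH.
have [R RP] := tg_morphism_image phiM sK.
apply/splitsP; exists R; apply/complP; split.
  apply/trivgP/fintype.subsetP => s /setIP[Qs /RP[x Kx xs]].
  have : (H `&` K) x by split=> //; rewrite /H /= xs.
  by rewrite HK1 => x1; rewrite -xs x1 tg_morphism1 // inE.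
apply/eqP; rewrite finset.eqEsubset; apply/andP; split; apply/fintype.subsetP => s.
  case/mulsgP=> t u Qt /RP[x _ xu] ->.
  have /PP[y _ yt] := fintype.subsetP sQP t Qt.
  by apply/PP; exists (y * x) => //; rewrite phiM yt xu.
move=> /PP[x _ <-]; have [h [k [Hh [Kk ->]]]] : tg_setmul G H K x by rewrite HKT.
by rewrite phiM mem_mulg //; apply/RP; exists k.
Qed.

(** A nontrivial commutator of two elements of the derived subgroup would survive in a finite
    quotient by an open normal subgroup, where the second derived subgroup is trivial. *)
Lemma profinite_C_derived_commutative : profinite_C_group G ->
  tg_commutative G (tg_derived G).
Proof.
move=> CG x y Dx Dy; have [pfG _] := CG; have [cT [hT _]] := pfG.
apply: (@tg_mulI _ G (x^-1 * y^-1)); apply/esym.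
rewrite !tgE.
apply: contrapT => nxy.
have : nbhs 1 (~` [set tg_commutator G x y]).
  apply: open_nbhs_nbhs; split; last by move=> E; apply: nxy; rewrite E.
  by apply/closed_openC/accessible_closed_set1/hausdorff_accessible.
move=> /(profinite_open_normal pfG)[N [sN nN nsN NU]].
have [s sT] := compact_coset_representatives cT sN nN.
have [X [phi [phiM phiN]]] := finite_index_perm_morphism sN nsN sT.
have [P PP] := tg_morphism_image phiM (tg_subgroupT G).
have CP : complemented_group P.
  apply: (profinite_C_quotient_complemented CG phiM) PP.
  by apply: filterS nN => z /phiN.
have phiC u v : phi (tg_commutator G u v) = [~ phi u, phi v]%g.
  by rewrite /tg_commutator !phiM !tg_morphismV // commgEl /conjg !mulgA.
have derP z : tg_derived G z -> (phi z \in P^`(1))%g.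
  pose H := [set z | (phi z \in P^`(1))%g].
  suff : tg_derived G `<=` H by apply.
  apply: tg_generated_min.
    split; first by rewrite /H /= tg_morphism1.
    split=> [u v|u] /=; first by rewrite /H /= phiM; exact: groupM.
    by rewrite /H /= tg_morphismV // groupV.
  move=> _ [u [v ->]]; rewrite /H /= phiC.
  by apply: mem_commg; apply/PP; [exists u|exists v].
have : (phi (tg_commutator G x y) \in P^`(2))%g.
  by rewrite phiC; apply: mem_commg; exact: derP.
rewrite complemented_der2 // => /set1P /phiN /NU.
exact.
Qed.

End Quotient.

(** * Conjugacy classes and centralisers *)

Section Orbits.
Context {T : topologicalType} (G : topGroup T).
Implicit Types (x y z g h a b : T) (A B D F H K M N S : set T).

Local Notation "x * y" := (gmul G x y).
Local Notation "x ^-1" := (ginv G x).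
Local Notation "1" := (gone G).
Local Notation sg := (tg_subgroup G).
Local Notation gen := (tg_generated G).

Definition tg_orbit x : set T := [set tg_conj G g x | g in [set: T]].

Lemma finite_orbit_subgroup : sg [set x | finite_set (tg_orbit x)].
Proof.
split; first by apply: sub_finite_set (finite_set1 1) => _ [g _ <-]; rewrite tg_conj1.
split=> [x y fx fy|x fx] /=.
  apply: (@sub_finite_set _ _ [set u * v | u in (tg_orbit x) & v in (tg_orbit y)]).
    move=> _ [g _ <-]; rewrite tg_conjM; exists (tg_conj G g x); first by exists g.
    by exists (tg_conj G g y); first by exists g.
  exact: finite_image2.
apply: (@sub_finite_set _ _ (ginv G @` (tg_orbit x))); last exact: finite_image.
by move=> _ [g _ <-]; rewrite tg_conjV; exists (tg_conj G g x); [exists g|].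
Qed.

(** The other conjugates of [a] form a finite, hence closed, set, which conjugation by elements near
    1 avoids by continuity. *)
Lemma finite_orbit_stabiliser a : hausdorff_space T -> finite_set (tg_orbit a) ->
  nbhs 1 [set g | tg_conj G g a = a].
Proof.
move=> hT fa; pose E := (tg_orbit a) `\ a.
have clE : closed E.
  apply: (iffLR accessible_finite_set_closed (hausdorff_accessible hT)).
  exact: finite_setD.
have nE : nbhs a (~` E).
  by apply: open_nbhs_nbhs; split; [exact: closed_openC clE|case=> _ /(_ erefl)].
have nC : nbhs 1 [set g | (~` E) (tg_conj G g a)].
  have : tg_conj G ^~ a @ 1 --> tg_conj G 1 a by exact: tg_continuous_conjl.
  by rewrite tg_conj1l; apply.
apply: filterS nC => g nEg.
by apply: contrapT => ga; apply: nEg; split=> //; exists g.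
Qed.

(** Modulo a small enough [N], the element [a] is distinct from its other conjugates, so fixing the
    coset aN means fixing [a]. *)
Lemma exists_separating_open_normal a M : @tg_profinite T ->
  finite_set (tg_orbit a) -> nbhs 1 M ->
  exists N, [/\ sg N, nbhs 1 N, tg_normalises G setT N, N `<=` M &
    forall g, N (a^-1 * tg_conj G g a) -> tg_conj G g a = a].
Proof.
move=> pfT fa nM; have [_ [hT _]] := pfT.
pose E := (gmul G a^-1 @` (tg_orbit a)) `\ 1.
have clE : closed E.
  apply: (iffLR accessible_finite_set_closed (hausdorff_accessible hT)).
  exact/finite_setD/finite_image.
have nE : nbhs 1 (~` E).
  by apply: open_nbhs_nbhs; split; [exact: closed_openC clE|case=> _ /(_ erefl)].
have [N [sN nN nsN NME]] := profinite_open_normal pfT (filterI nM nE).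
exists N; split=> // [x /NME[]//|g Ng].
apply: contrapT => ga; have [_] := NME _ Ng; apply; split.
  by exists (tg_conj G g a) => //; exists g.
by move=> /tg_eqV /esym.
Qed.

(* If no pair (a, N) is as claimed, build a_(k+1) = a_k x_k with x_k in shrinking
   N_k such that the stabilisers of the a_k decrease strictly; each stabiliser of a
   point of a_k N_k lies in that of a_k, so a cluster point has an infinite orbit. *)
Lemma finite_orbits_locally_fixed A : @tg_profinite T -> sg A -> closed A ->
  tg_commutative G A -> (forall a, A a -> finite_set (tg_orbit a)) ->
  exists a N, [/\ A a, sg N, nbhs 1 N &
    forall y g, A y -> N y -> tg_conj G g a = a -> tg_conj G g y = y].
Proof.
move=> pfT sA clA cA fA; have [cT [hT _]] := pfT; apply: contrapT => noaN.
pose P (p : T * set T) := [/\ A p.1, sg p.2, nbhs 1 p.2, tg_normalises G setT p.2 &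
  forall g, p.2 (p.1^-1 * tg_conj G g p.1) -> tg_conj G g p.1 = p.1].
pose R (p q : {p : T * set T | P p}) := [/\ (sval q).2 `<=` (sval p).2,
  (sval p).2 ((sval p).1^-1 * (sval q).1) &
  exists g, tg_conj G g (sval p).1 = (sval p).1 /\
    tg_conj G g (sval q).1 <> (sval q).1].
(* If [g] fixes b, then p.1^-1 times the conjugate of p.1 is c times the inverse of its conjugate,
   for c = p.1^-1 b in the normal subgroup p.2. *)
have fix_sub p b g : P p -> p.2 (p.1^-1 * b) ->
    tg_conj G g b = b -> tg_conj G g p.1 = p.1.
  move=> [_ sN _ nN sepN] Nb gb; apply: sepN.
  rewrite (_ : _ * _ = p.1^-1 * b * (tg_conj G g (p.1^-1 * b))^-1).
    by apply: tg_subgroupM => //; apply: tg_subgroupV => //; apply: nN.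
  apply: (@tg_mulI _ G p.1); apply: (@tg_mulIr _ G (tg_conj G g (p.1^-1 * b))).
  by rewrite !tgE; exact: gb.
have stepR p : {q | R p q}.
  apply: cid; case: p => -[a N] Pp; have [Aa sN nN nsN sepN] := Pp.
  rewrite /= in Aa sN nN nsN sepN.
  have [y [g [[Ay Ny] [ga gy]]]] : exists y g,
      (A y /\ N y) /\ tg_conj G g a = a /\ tg_conj G g y <> y.
    apply: contrapT => nyg; apply: noaN; exists a, N; split=> // y g Ay Ny ga.
    by apply: contrapT => gy; apply: nyg; exists y, g.
  have Aay : A (a * y) by exact: tg_subgroupM.
  have [N' [sN' nN' nsN' N'N sepN']] := exists_separating_open_normal pfT (fA _ Aay) nN.
  have Pq : P (a * y, N') by split.
  exists (exist _ _ Pq); split=> //=; first by rewrite !tgE.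
  exists g; split=> //; rewrite tg_conjM ga => /tg_mulI; exact: gy.
have [N0 [sN0 nN0 nsN0 _ sepN0]] :=
  exists_separating_open_normal pfT (fA _ (tg_subgroup1 sA)) filterT.
have P0 : P (1, N0) by split=> //; apply: tg_subgroup1.
have [f [_ fR]] := dependent_choice stepR (exist _ _ P0).
pose u n := (sval (f n)).1; pose N n := (sval (f n)).2.
have Pf n : P (u n, N n) by rewrite /u /N -surjective_pairing; apply: svalP.
have uN k m : N (k + m)%N `<=` N k /\ N k ((u k)^-1 * u (k + m)%N).
  elim: m => [|m [NN uk]].
    by rewrite addn0 gmulV; split=> //; apply: tg_subgroup1; have [] := Pf k.
  rewrite addnS; have [NS uS _] := fR (k + m)%N; split; first exact: subset_trans NN.
  have [_ sN _ _ _] := Pf k.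
  have := tg_subgroupM sN uk (NN _ uS); rewrite !tgE; exact.
have cptA : compact A by apply: subclosed_compact clA cT _.
have [b [Ab club]] : A `&` cluster (u @ \oo) !=set0.
  by apply: cptA; exists 0%N => // n _; have [] := Pf n.
(* From index k on, the sequence stays in the closed coset of [N k] containing [u k], so its cluster
   point lies there too. *)
have uNb k : N k ((u k)^-1 * b).
  have [_ sN nN _ _] := Pf k.
  have clNk : closed (gmul G (u k)^-1 @^-1` N k).
    apply: preimage_closed => [z _|]; first exact: tg_continuousMl.
    exact: closed_subgroup_nbhs1 sN nN.
  apply: clNk => B Bb; apply: club => //.
  by exists k => // m /= km; have [_] := uN k (m - k)%N; rewrite subnKC.
have gP n : {g | tg_conj G g (u n) = u n /\ tg_conj G g (u n.+1) <> u n.+1}.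
  by apply: cid; have [] := fR n.
pose g n := sval (gP n).
have gS n : tg_conj G (g n) (u n) = u n by case: (svalP (gP n)).
have gN n : tg_conj G (g n) (u n.+1) <> u n.+1 by case: (svalP (gP n)).
(* If the conjugates agree, g_j^-1 g_k fixes b and hence u_(j+1). Since g_k fixes u_k, it fixes
   u_(j+1) as well, so g_j fixes u_(j+1), contrary to its choice. *)
have inj_g j k : (j < k)%N -> tg_conj G (g j) b <> tg_conj G (g k) b.
  move=> jk E; apply: (gN j).
  have bb : tg_conj G ((g j)^-1 * g k) b = b by rewrite tg_conjMl -E tg_conjK.
  have := fix_sub (u j.+1, N j.+1) _ _ (Pf _) (uNb _) bb; rewrite /= tg_conjMl.
  have [_ ujk] := uN j.+1 (k - j.+1)%N; rewrite subnKC // in ujk.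
  have -> := fix_sub (u j.+1, N j.+1) _ _ (Pf _) ujk (gS k).
  by move=> /(congr1 (tg_conj G (g j))); rewrite tg_conjVK.
apply: infinite_nat.
have inj_f : injective (fun n => tg_conj G (g n) b).
  move=> j k E; have [jk|kj|//] := ltngtP j k.
    by case: (inj_g _ _ jk).
  by case: (inj_g _ _ kj).
rewrite -(eq_finite_set (inj_card_eq (in2W inj_f))).
by apply: sub_finite_set (fA _ Ab) => _ [n _ <-]; exists (g n).
Qed.

(** An element fixing both [a] and [y] fixes the part of yN in [A]. Both stabilisers are
    neighbourhoods of 1, and compactness of [A] makes the choice uniform. *)
Lemma finite_orbits_centraliser_open A : @tg_profinite T -> sg A -> closed A ->
  tg_commutative G A -> (forall a, A a -> finite_set (tg_orbit a)) ->
  nbhs 1 [set g | forall y, A y -> tg_conj G g y = y].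
Proof.
move=> pfT sA clA cA fA; have [cT [hT _]] := pfT.
have [a [N [Aa sN nN aN]]] := finite_orbits_locally_fixed pfT sA clA cA fA.
have cptA : compact A by apply: subclosed_compact clA cT _.
move/compact_near_coveringP/near_covering_withinP: cptA.
move=> /(_ T (nbhs 1) (fun g y => tg_conj G g y = y)); apply=> y Ay.
exists ([set z | N (y^-1 * z)],
  [set g | tg_conj G g a = a] `&` [set g | tg_conj G g y = y]).
  split; first exact: nbhs1_translate.
  by apply: filterI; apply: finite_orbit_stabiliser => //; apply: fA.
move=> [z g] /= [Nz [ga gy]] Az.
have -> : z = y * (y^-1 * z) by rewrite !tgE.
rewrite tg_conjM gy (aN (y^-1 * z)) //.
by apply: tg_subgroupM => //; apply: tg_subgroupV.
Qed.

Lemma tg_derived_subgroup : sg (tg_derived G).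
Proof. exact: tg_generated_subgroup. Qed.

Lemma tg_derived_normal : tg_normalises G setT (tg_derived G).
Proof.
move=> g x _ Dx; have := tg_generated_conj (g := g) Dx.
apply: tg_generated_min => [|_ [_ [u [v ->]] <-]]; first exact: tg_derived_subgroup.
apply: tg_generated_sub; exists (tg_conj G g u), (tg_conj G g v).
by rewrite /tg_commutator !tg_conjM !tg_conjV.
Qed.

End Orbits.

(** * Splitting over the closed derived subgroup, and the equivalence *)

Section Structure.
Context {T : topologicalType} (G : topGroup T).
Implicit Types (x y z g h a b : T) (A B D F H K M N S : set T).

Local Notation "x * y" := (gmul G x y).
Local Notation "x ^-1" := (ginv G x).
Local Notation "1" := (gone G).
Local Notation sg := (tg_subgroup G).
Local Notation gen := (tg_generated G).
Local Notation Z := (tg_center G).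
Local Notation G' := (closure (tg_derived G)).

Lemma tg_center_subgroup : sg Z.
Proof.
split; first by move=> x; rewrite gmul1 tg_mul1.
split=> [x y zx zy z|x zx z]; first by rewrite -gmulA zy gmulA zx gmulA.
by apply: (@tg_mulI _ G x); apply: (@tg_mulIr _ G x); rewrite !tgE zx.
Qed.

Lemma tg_center_mul_subgroup A : sg A -> sg (tg_setmul G Z A).
Proof.
move=> sA; apply: tg_setmul_subgroup => //; first exact: tg_center_subgroup.
by move=> x y zx _; rewrite -gmulA zx tgE gmulV gmul1.
Qed.

(** It suffices to treat the minimal generators of [A]: the class of such an x stays inside <x>,
    which is finite by torsion. *)
Lemma C_group_finite_orbit A : C_group G -> sg A -> tg_commutative G A ->
  tg_normalises G setT A -> forall a, A a -> finite_set (tg_orbit G a).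
Proof.
move=> CG sA cA nA a Aa; have torG := C_group_torsion CG.
have := complemented_generated_minimal (tg_subgroupT G) sA (@subsetT _ _) cA nA
  (fun D sD _ => CG D sD) Aa.
apply: (tg_generated_min (finite_orbit_subgroup G)) => x [[nx _] _].
have [n [n0 xn]] := torG x.
by apply: sub_finite_set (finite_cycle n0 xn) => _ [g _ <-]; apply: nx.
Qed.

Lemma finite_index_finite_orbit A : sg A -> tg_commutative G A ->
  tg_finite_index G (tg_setmul G Z A) ->
  forall a, A a -> finite_set (tg_orbit G a).
Proof.
move=> sA cA finZA a Aa.
(* The conjugate of [a] by g depends only on the coset of g, since ZA centralises [a]; [xget] picks
   a representative, its default 1 being irrelevant on nonempty cosets. *)
apply: (@sub_finite_set _ _
  ((fun C => tg_conj G (xget 1 C) a) @` tg_lcosets G (tg_setmul G Z A))); last first.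
  exact: finite_image.
move=> _ [g _ <-]; exists [set g * h | h in tg_setmul G Z A]; first by exists g.
have [|_ [z [a' [zz [Aa' ->]]]] <-] := @xgetPex _ 1 [set g * h | h in tg_setmul G Z A].
  exists (g * 1); exists 1 => //; apply: tg_subgroup1.
  exact: tg_center_mul_subgroup.
rewrite !tg_conjMl; congr (tg_conj G g _).
rewrite (_ : tg_conj G a' a = a); last by apply/tg_conj_id; exact: cA.
by apply/tg_conj_id; exact: zz.
Qed.

Lemma profinite_C_group_C_groupP : profinite_C_group G ->
  C_group G <-> (tg_torsion G /\ tg_finite_index G (tg_setmul G Z G')).
Proof.
move=> CG; have [pfG complG] := CG; have [cT [hT _]] := pfG.
have sA : sg G' by apply: closure_subgroup; apply: tg_derived_subgroup.
have clA : closed G' by exact: closed_closure.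
have cA : tg_commutative G G'.
  by apply: (closure_commutative hT); apply: profinite_C_derived_commutative.
have nA : tg_normalises G setT G'.
  by apply: closure_normalises; apply: tg_derived_normal.
have [B [clB [sB [ABT AB1]]]] := complG _ sA clA.
(* Commutators of elements of [B] lie in both [G'] and [B]. *)
have cB : tg_commutative G B.
  move=> x y Bx By; suff E : tg_commutator G x y = 1.
    apply/esym; apply: (@tg_eqV _ G); rewrite -[RHS]E /tg_commutator.
    by rewrite !tgE.
  have : (G' `&` B) (tg_commutator G x y); last by rewrite AB1.
  split; first by apply: subset_closure; apply: tg_generated_sub; exists x, y.
  by do 3?[apply: tg_subgroupM => //]; apply: tg_subgroupV.
split=> [CgG|[torG finZA]].
  split; first exact: C_group_torsion.
  have sZA := tg_center_mul_subgroup sA.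
  apply: (compact_finite_index cT sZA).
  (* The centraliser of [G'] is a neighbourhood of 1. If g = a b lies in it, so does b; as [B] is
     abelian, b is then central and g lies in ZA. *)
  have := finite_orbits_centraliser_open pfG sA clA cA
    (C_group_finite_orbit CgG sA cA nA).
  apply: filterS => g /= cg.
  have [a [b [Aa [Bb gE]]]] : tg_setmul G G' B g by rewrite ABT.
  have cb y : G' y -> b * y = y * b.
    move=> Ay; apply/tg_conj_id; have := cg _ Ay; rewrite gE tg_conjMl => E.
    have cay : tg_conj G a y = y by apply/tg_conj_id; exact: cA.
    by rewrite -(tg_conjK G a (tg_conj G b y)) E -{1}cay tg_conjK.
  rewrite gE -(cb _ Aa); exists b, a; split=> //.
  move=> y; have [a' [b' [Aa' [Bb' ->]]]] : tg_setmul G G' B y by rewrite ABT.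
  by rewrite gmulA cb // -gmulA (cB _ _ Bb Bb') gmulA.
apply: (C_group_semidirect sA sB nA ABT AB1).
  apply: (profinite_C_torsion_complement CG torG) => //.
  exact: finite_index_finite_orbit.
move=> D sD DB.
(* Here [B] acts on itself: it is abelian, so the conjugacy classes are singletons. *)
have [|b Bb|K [sK KB _ BDK DK1]] :=
    profinite_C_torsion_complement CG torG sB sB (@subset_refl _ _) cB _ _ sD DB.
- move=> g x Bg Bx; rewrite (_ : tg_conj G g x = x) //.
  by apply/tg_conj_id; exact: cB.
- apply: sub_finite_set (finite_set1 b) => _ [g Bg <-].
  by apply/tg_conj_id; exact: cB.
- by exists K.
Qed.

End Structure.

Theorem theoremC (T : topologicalType) (G : topGroup T) :
  profinite_C_group G ->
  (C_group G <->
     (tg_torsion G /\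
      tg_finite_index G (tg_setmul G (tg_center G) (closure (tg_derived G))))) /\
  (tg_abelian G -> (C_group G <-> tg_torsion G)).
Proof.
move=> CG; split; first exact: profinite_C_group_C_groupP.
move=> abG; rewrite profinite_C_group_C_groupP //; split=> [[]//|torG]; split=> //.
(* The centre is the whole group, so the only coset is the full set. *)
apply: sub_finite_set (finite_set1 [set: T]) => _ [g _ <-].
rewrite /= -subTset => x _; exists (gmul G (ginv G g) x); last by rewrite !tgE.
apply: tg_setmul_subl; last by move=> y; apply: abG.
by apply: closure_subgroup; apply: tg_derived_subgroup.
Qed.
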